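(* Let $n\ge 3$ and let $R$ be an almost commutative ring with center $C$, i.e. $R$ is finitely generated as a $C$-module. Let $\mathrm{Max}(C)$ be the set of maximal ideals of $C$. Let $\sigma\in \mathrm{GL}_n(R)$, let $i,j,k,l\in\{1,\dots,n\}$ with $i\neq j$ and $k\neq l$, and let $a,b,c\in R$. Then (i) $t_{kl}(a\sigma_{ij}b)$ is a finite product of $8|\mathrm{Max}(C)|$ or less $\mathrm{E}_n(R)$-conjugates of $\sigma$ and $\sigma^{-1}$, and (ii) $t_{kl}(a(c\sigma_{ii}-\sigma_{jj}c)b)$ is a finite product of $24|\mathrm{Max}(C)|$ or less $\mathrm{E}_n(R)$-conjugates of $\sigma$ and $\sigma^{-1}$.
   Context: Rings are associative with $1\neq 0$, not necessarily commutative. $|\mathrm{Max}(C)|$ may be infinite; in that case the bound only asserts that the product is finite. $\mathrm{GL}_n(R)$ is the group of invertible $n\times n$ matrices over $R$; $\sigma_{ij}$ is the $(i,j)$ entry of $\sigma$. For $i\ne j$ and $x\in R$, $t_{ij}(x)=e+xe^{ij}$, where $e$ is the identity matrix and $e^{ij}$ is the matrix with $1$ at position $(i,j)$ and $0$ elsewhere. $\mathrm{E}_n(R)$ is the subgroup of $\mathrm{GL}_n(R)$ generated by all $t_{ij}(x)$ ($i\neq j$, $x\in R$). For $g,h$ in a group, $g^h=h^{-1}gh$. ''A product of $m$ $\mathrm{E}_n(R)$-conjugates of $\sigma$ and $\sigma^{-1}$'' means a product of $m$ factors, each of the form $\sigma^{\xi}$ or $(\sigma^{-1})^{\xi}$ with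 $\xi\in \mathrm{E}_n(R)$. *)

(* Defs.v *)
From HB Require Import structures.
From mathcomp Require Import all_boot all_order all_algebra.
From mathcomp Require Import boolp classical_sets functions cardinality.

Set Implicit Arguments.
Unset Strict Implicit.
Unset Printing Implicit Defensive.

Import GRing.Theory.
Local Open Scope ring_scope.
Local Open Scope classical_set_scope.

Section Center.
Variable R : nzRingType.

Definition central : {pred R} := fun z => `[< forall x, z * x = x * z >].

Record center := Center { center_val :> R; centerP : center_val \in central }.

HB.instance Definition _ := [isSub for center_val].
HB.instance Definition _ := [Choice of center by <:].

Lemma central_subring : subring_closed central.
Proof.
split=> [|z w /asboolP zC /asboolP wC|z w /asboolP zC /asboolP wC];
  apply/asboolP => x.
- by rewrite mul1r mulr1.
- by rewrite mulrBl mulrBr zC wC.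
- by rewrite -mulrA wC mulrA zC mulrA.
Qed.

HB.instance Definition _ :=
  GRing.isSubringClosed.Build R central central_subring.
HB.instance Definition _ := [SubChoice_isSubNzRing of center by <:].

Lemma center_mulC : commutative (@GRing.mul center).
Proof.
by move=> z w; apply: val_inj; rewrite !rmorphM; case: z => z /= /asboolP.
Qed.

HB.instance Definition _ :=
  GRing.PzRing_hasCommutativeMul.Build center center_mulC.

Definition almost_commutative :=
  exists (m : nat) (r : 'I_m -> R),
    forall x, exists c : 'I_m -> center, x = \sum_(p < m) val (c p) * r p.

End Center.

(* [idealr_closed] includes properness. *)
Definition maximal_ideal (C : comNzRingType) (I : set C) :=
  idealr_closed (mem I) /\
  forall J : set C, idealr_closed (mem J) -> I `<=` J -> J = I.

Definition Max (C : comNzRingType) : set (set C) := [set I | maximal_ideal I].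
Arguments Max : clear implicits.

(* The library's [unitmx] and ['GL_n[R]] need a commutative [R]. *)
Section GeneralLinear.
Variables (n : nat) (R : nzRingType).

Definition invertible_mx (A : 'M[R]_n) :=
  exists B : 'M[R]_n, A *m B = 1%:M /\ B *m A = 1%:M.

Record GL := MkGL { GLval :> 'M[R]_n; GLP : `[< invertible_mx GLval >] }.

HB.instance Definition _ := [isSub for GLval].
HB.instance Definition _ := [Choice of GL by <:].

Definition mkGL (A B : 'M[R]_n) (AB : A *m B = 1%:M) (BA : B *m A = 1%:M) : GL :=
  MkGL (asboolT (ex_intro _ B (conj AB BA))).

Lemma invertible_mx1 : (1%:M : 'M[R]_n) *m 1%:M = 1%:M.
Proof. exact: mulmx1. Qed.

Definition GL1 : GL := mkGL invertible_mx1 invertible_mx1.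

Lemma invertible_mxM (g h : GL) : invertible_mx (GLval g *m GLval h).
Proof.
case: g h => [A /asboolP[A' [AA' A'A]]] [B /asboolP[B' [BB' B'B]]] /=.
exists (B' *m A'); split.
  by rewrite mulmxA -(mulmxA A) BB' mulmx1.
by rewrite mulmxA -(mulmxA B') A'A mulmx1.
Qed.

Definition GLmul (g h : GL) : GL := MkGL (asboolT (invertible_mxM g h)).

Definition GLinv (g : GL) : GL :=
  let: exist _ (conj AB BA) := cid (asboolW (GLP g)) in mkGL BA AB.

Lemma GLmulA : associative GLmul.
Proof. by move=> f g h; apply: val_inj; rewrite /= mulmxA. Qed.

Lemma GLmul1 : left_id GL1 GLmul.
Proof. by move=> g; apply: val_inj; rewrite /= mul1mx. Qed.

Lemma GLmulr1 : right_id GL1 GLmul.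
Proof. by move=> g; apply: val_inj; rewrite /= mulmx1. Qed.

Lemma GLmulV : left_inverse GL1 GLinv GLmul.
Proof.
by move=> g; apply: val_inj; rewrite /= /GLinv; case: cid => B [AB BA] /=.
Qed.

Lemma GLmulrV : right_inverse GL1 GLinv GLmul.
Proof.
by move=> g; apply: val_inj; rewrite /= /GLinv; case: cid => B [AB BA] /=.
Qed.

HB.instance Definition _ :=
  isGroup.Build GL GLmulA GLmul1 GLmulr1 GLmulV GLmulrV.

Definition transvection_mx (i j : 'I_n) (x : R) : 'M[R]_n :=
  1%:M + x *: delta_mx i j.

Lemma transvection_mxN (i j : 'I_n) (x : R) : i != j ->
  transvection_mx i j x *m transvection_mx i j (- x) = 1%:M.
Proof.
move=> ij; rewrite /transvection_mx mulmxDl mul1mx mulmxDr mulmx1.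
rewrite [X in _ + (_ + X)](_ : _ = 0) ?addr0.
  by rewrite scaleNr addrNK.
apply/matrixP => p q; rewrite !mxE big1 // => r _; rewrite !mxE.
have [->|_] := eqVneq r j; last by rewrite andbF mulr0 mul0r.
by rewrite [j == i]eq_sym (negbTE ij) /= !mulr0.
Qed.

Lemma transvection_mxNl (i j : 'I_n) (x : R) : i != j ->
  transvection_mx i j (- x) *m transvection_mx i j x = 1%:M.
Proof. by move=> ij; rewrite -{2}(opprK x) transvection_mxN. Qed.

Definition transvection (i j : 'I_n) (ij : i != j) (x : R) : GL :=
  mkGL (transvection_mxN x ij) (transvection_mxNl x ij).

Definition elementary : set GL :=
  smallest (fun H : set GL => group_closed (mem H))
    [set g | exists (i j : 'I_n) (ij : i != j) (x : R), g = transvection ij x].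

Definition elementary_conjugates (sigma : GL) : set GL :=
  [set g | exists2 xi, elementary xi &
     g = (sigma ^ xi)%g \/ g = (sigma^-1 ^ xi)%g].

Definition product_of_conjugates (m : nat) (sigma tau : GL) :=
  exists2 g : 'I_m -> GL, (forall p, elementary_conjugates sigma (g p)) &
    tau = (\prod_(p < m) g p)%g.

End GeneralLinear.

(* Main.v *)
Require Import Defs.
From Stdlib Require Import Ncring Ncring_tac.
From mathcomp Require Import all_boot all_order all_fingroup all_algebra.
From mathcomp Require Import boolp classical_sets functions cardinality.
From mathcomp Require Import zify.
Import GRing.Theory.
Local Open Scope ring_scope.
Local Open Scope classical_set_scope.
Local Open Scope card_scope.

(** The proof is a local-global argument over the center [C] of [R].

    Local step. Fix a maximal ideal [M] of [C]. The quotient of [R] by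
    [M * R] is a finite dimensional algebra over the residue field of [M],
    hence Artinian, hence of stable range one ([stable_range]); by Nakayama's
    lemma ([nakayama_left_inv]) the same holds for [R] itself once a
    denominator [s] in [C] outside of [M] is allowed ([local_stable_range]).
    Column [j] of [sigma] is unimodular, so after conjugating [sigma] by an
    elementary matrix its entry [d] at [(j, j)] satisfies [d' * d = s], while
    the entry at [(i, j)] is unchanged.

    With such a pivot one can write down a transvection that fixes column [j]
    of [sigma]. Its commutator with [sigma] is a product of two conjugates,
    with the explicit column [e_j + e_h * x], where [x * d = s * sigma i j]
    ([pivot_column]). Two more commutators, each doubling the number of
    factors, isolate the transvection with entry [a * x * y] at [(j, i)]
    ([product_of_column]), and [y := d * b] gives the entry
    [s * (a * sigma i j * b)] as a product of [2 * 2 * 2 = 8] conjugates. All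
    transvections with this entry are conjugate under elementary matrices
    because [n >= 3] ([transvection_conj_all]).

    Global step. The denominators [s], one for each [M], lie in no common
    maximal ideal, so 1 is a combination of finitely many of them, attached
    to pairwise distinct maximal ideals ([partition_of_unity]). The
    transvection with entry [a * sigma i j * b] is the corresponding product
    of local ones. This gives the bound eight times the number of maximal
    ideals.

    For the second part, conjugating [sigma] by the transvection with entry
    [- c] at [(j, i)] produces the entry
    [sigma j i + (c * sigma i i - sigma j j * c) - c * sigma i j * c] at
    [(j, i)], and three applications of the first part suffice. *)

Set Implicit Arguments.
Unset Strict Implicit.
Unset Printing Implicit Defensive.

(** These instances let [non_commutative_ring] decide identities in an
    arbitrary associative ring; the arguments below verify many identities
    between noncommuting elements. *)
Section NcringBridge.
Variable R : pzRingType.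

#[local] Instance pzRing_ops :
  @Ring_ops R 0 1 +%R *%R (fun x y => x - y) -%R eq := {}.

#[local] Instance pzRing_Ring : @Ring R _ _ _ _ _ _ _ pzRing_ops.
Proof.
split; try exact: eq_equivalence; try by move=> ? ? -> ? ? ->.
- by move=> ? ? ->.
- exact: add0r.
- exact: addrC.
- exact: addrA.
- exact: mul1r.
- exact: mulr1.
- exact: mulrA.
- exact: mulrDl.
- by move=> x y z; exact: mulrDr.
- by [].
- exact: subrr.
Qed.

End NcringBridge.

(** * Stable range one for Artinian quotient rings *)

Section Artinian.
Variable R : pzRingType.
#[local] Existing Instance pzRing_ops.
#[local] Existing Instance pzRing_Ring.
Implicit Types (X Y L K J B : set R) (a b d e r u x y : R).

Definition left_ideal X :=
  [/\ X 0, forall x y, X x -> X y -> X (x + y) & forall r x, X x -> X (r * x)].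

Definition two_sided_ideal J := left_ideal J /\ forall x r, J x -> J (x * r).

(** The chain conditions on left ideals above [J] are all that is needed, and
    a bounded strictly monotone rank provides both of them at once. Every
    ideal occurring below is compared with [J] by congruences, so that no
    quotient ring has to be formed. *)
Definition finite_length_mod J := exists (len : set R -> nat) (N : nat),
  (forall X, (len X <= N)%N) /\
  forall X Y, left_ideal X -> left_ideal Y -> J `<=` X -> X `<` Y ->
    (len X < len Y)%N.

Lemma left_idealB X x y : left_ideal X -> X x -> X y -> X (x - y).
Proof.
by case=> _ XD XM Xx Xy; rewrite -[y]mul1r -mulNr; apply: XD => //; apply: XM.
Qed.

Lemma left_ideal_of_sub X x y : left_ideal X -> X (x - y) -> X y -> X x.
Proof. by case=> _ XD _ Xxy Xy; rewrite -(subrK y x); apply: XD. Qed.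

Lemma finite_length_mod_sub I J :
  I `<=` J -> finite_length_mod I -> finite_length_mod J.
Proof.
move=> IJ [len [N [lenN len_lt]]]; exists len, N; split=> // X Y lX lY JX XY.
by apply: len_lt => //; exact: subset_trans JX.
Qed.

Lemma ascending_stable J (X : nat -> set R) : finite_length_mod J ->
  (forall n, left_ideal (X n)) -> (forall n, J `<=` X n) ->
  (forall n, X n `<=` X n.+1) -> exists n, X n.+1 `<=` X n.
Proof.
move=> [len [N [lenN len_lt]]] lX JX XS; apply: contrapT => /forallNP unstable.
suff lenX n : (n <= len (X n))%N by have := lenX N.+1; rewrite ltnNge lenN.
elim: n => // n IHn; apply: leq_ltn_trans IHn _.
exact: (len_lt _ _ (lX _) (lX _) (JX _)).
Qed.

Lemma descending_stable J (X : nat -> set R) : finite_length_mod J ->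
  (forall n, left_ideal (X n)) -> (forall n, J `<=` X n) ->
  (forall n, X n.+1 `<=` X n) -> exists n, X n `<=` X n.+1.
Proof.
move=> [len [N [lenN len_lt]]] lX JX XS; apply: contrapT => /forallNP unstable.
suff lenX n : (len (X n) + n <= N)%N.
  by have := leq_trans (leq_addl _ _) (lenX N.+1); rewrite ltnn.
elim: n => [|n IHn]; first by rewrite addn0.
apply: leq_trans IHn; rewrite addnS -addSn leq_add2r.
exact: (len_lt _ _ (lX _) (lX _) (JX _)).
Qed.

Section Modulus.
Variable J : set R.
Hypothesis J_ideal : two_sided_ideal J.

Let lJ : left_ideal J. Proof. by case: J_ideal. Qed.
Let J0 : J 0. Proof. by case: lJ. Qed.
Let JD x y : J x -> J y -> J (x + y). Proof. by case: lJ => _ + _; apply. Qed.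
Let JMl r x : J x -> J (r * x). Proof. by case: lJ => _ _; apply. Qed.
Let JMr r x : J x -> J (x * r). Proof. by case: J_ideal => _; apply. Qed.
Let JB x y : J x -> J y -> J (x - y). Proof. exact: left_idealB. Qed.
Let JN x : J x -> J (- x). Proof. by rewrite -sub0r; exact: JB. Qed.

Definition preim_mulr X d := [set x | X (x * d)].

Definition add_mulr X d := [set x | exists2 q, X q & J (x - q * d)].

Lemma left_ideal_preim_mulr X d : left_ideal X -> left_ideal (preim_mulr X d).
Proof.
case=> X0 XD XM; split; rewrite /preim_mulr /=.
- by rewrite mul0r.
- by move=> x y Xx Xy; rewrite mulrDl; apply: XD.
- by move=> r x Xx; rewrite -mulrA; apply: XM.
Qed.

Lemma left_ideal_add_mulr X d : left_ideal X -> left_ideal (add_mulr X d).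
Proof.
case=> X0 XD XM; split.
- by exists 0 => //; rewrite mul0r subr0.
- move=> x y [p Xp Jp] [q Xq Jq]; exists (p + q); first exact: XD.
  by rewrite mulrDl opprD addrACA; apply: JD.
- move=> r x [p Xp Jp]; exists (r * p); first exact: XM.
  by rewrite -mulrA -mulrBr; apply: JMl.
Qed.

Lemma sub_add_mulr X d : X 0 -> J `<=` add_mulr X d.
Proof. by move=> X0 x Jx; exists 0 => //; rewrite mul0r subr0. Qed.

(** In a Noetherian module a surjective endomorphism is injective. The
    endomorphism here is right multiplication by [y] modulo [J], and [L] need
    only be covered by its image: writing [l = q * y ^+ n] modulo [J], the
    kernels of the powers of [y] form an ascending chain of left ideals. *)
Lemma mulr_surj_inj L y : finite_length_mod J ->
  L `<=` add_mulr L y -> forall l, L l -> J (l * y) -> J l.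
Proof.
move=> finJ surj l Ll Jly.
have divn n x : L x -> exists2 q, L q & J (x - q * y ^+ n).
  elim: n x => [|n IHn] x Lx; first by exists x => //; rewrite mulr1 subrr.
  have [q Lq Jq] := surj _ Lx; have [p Lp Jp] := IHn _ Lq; exists p => //.
  have -> : x - p * y ^+ n.+1 = x - q * y + (q - p * y ^+ n) * y.
    by rewrite exprSr; move: (y ^+ n) => z; non_commutative_ring.
  by apply: JD => //; apply: JMr.
have [|||n kerS] := ascending_stable (X := fun n => preim_mulr J (y ^+ n)) finJ.
- by move=> n; apply: left_ideal_preim_mulr.
- by move=> n x Jx; apply: JMr.
- by move=> n x; rewrite /preim_mulr /= exprSr mulrA; apply: JMr.
have [q Lq Jq] := divn n _ Ll; apply: (left_ideal_of_sub lJ Jq); apply: kerS.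
rewrite /preim_mulr /= exprSr mulrA.
have -> : q * y ^+ n * y = l * y - (l - q * y ^+ n) * y.
  by rewrite mulrBl subKr.
by apply: JB => //; apply: JMr.
Qed.

(** The dual fact, from the descending chain of the left ideals generated by
    the powers of [d]: an equation [d ^+ n = u * d ^+ n.+1] modulo [J] can be
    cancelled down to [1 = u * d]. *)
Lemma mulr_inj_surj d : finite_length_mod J ->
  (forall x, J (x * d) -> J x) -> exists u, J (u * d - 1).
Proof.
move=> finJ inj.
have [|||n surj] :=
    descending_stable (X := fun n => add_mulr setT (d ^+ n)) finJ.
- by move=> n; apply: left_ideal_add_mulr.
- by move=> n; apply: sub_add_mulr.
- by move=> n x [q _ Jq]; exists (q * d) => //; rewrite -mulrA -exprS.
have [|u _ Ju] := surj (d ^+ n); first by exists 1; rewrite ?mul1r ?subrr.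
have {Ju} : J ((u * d - 1) * d ^+ n).
  by rewrite mulrBl mul1r -mulrA -exprS -opprB; apply: JN.
elim: n {surj} => [|n IHn]; first by rewrite mulr1; exists u.
by rewrite exprSr mulrA => /inj.
Qed.

(** The preimage of the Jacobson radical of the quotient by [J]. *)
Definition quasi_regular :=
  [set x | forall r, exists u, J (u * (1 - r * x) - 1)].

Lemma sub_quasi_regular : J `<=` quasi_regular.
Proof.
move=> x Jx r; exists 1; rewrite mul1r addrAC subrr add0r.
by apply: JN; apply: JMl.
Qed.

(** Stability under right multiplication rests on the classical identity that
    turns a left inverse [u] of [1 - s * r * x] into the left inverse
    [1 + r * x * u * s] of [1 - r * x * s]. *)
Lemma quasi_regular_ideal : two_sided_ideal quasi_regular.
Proof.
split; first split.
- exact: sub_quasi_regular.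
- move=> x y qx qy r; have [u Ju] := qx r; have [v Jv] := qy (u * r).
  exists (v * u).
  have -> : v * u * (1 - r * (x + y)) - 1 =
    (v * (1 - u * r * y) - 1) + v * (u * (1 - r * x) - 1).
    non_commutative_ring.
  by apply: JD => //; apply: JMl.
- by move=> r x qx s; rewrite mulrA; apply: qx.
- move=> x s qx r; have [u Ju] := qx (s * r).
  exists (1 + r * x * u * s).
  have -> : (1 + r * x * u * s) * (1 - r * (x * s)) - 1 =
    r * x * (u * (1 - s * r * x) - 1) * s.
    non_commutative_ring.
  by apply: JMr; apply: JMl.
Qed.

(** Left invertibility lifts along the Jacobson radical. *)
Lemma quasi_regular_left_inv u d :
  quasi_regular (u * d - 1) -> exists v, J (v * d - 1).
Proof.
move=> /(_ (-1)) [v Jv]; exists (v * u).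
by have -> : v * u * d = v * (1 - -1 * (u * d - 1)) by non_commutative_ring.
Qed.

Lemma nilpotent_left_inv x n : J (x ^+ n) -> exists u, J (u * (1 - x) - 1).
Proof.
move=> Jxn; exists (\sum_(i < n) x ^+ i).
have <- : - x ^+ n = (\sum_(i < n) x ^+ i) * (1 - x) - 1.
  elim: n {Jxn} => [|n IHn]; first by rewrite big_ord0 mul0r sub0r.
  rewrite big_ord_recr /= mulrDl addrAC -IHn mulrBr mulr1 -exprSr.
  by rewrite addKr.
exact: JN.
Qed.

Hypothesis finJ : finite_length_mod J.
Hypothesis radJ : quasi_regular `<=` J.

(** As [K] is not contained in the radical, some [x] in [K] has [1 - x] not
    left invertible; such an [x] is not nilpotent. By the descending chain
    condition a power [y] of [x] satisfies [y = w * y * y]. Right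
    multiplication by [y] maps the left ideal generated by [y] onto itself,
    so it is injective there; as [e := w * y] satisfies [e * y = y],
    cancelling [y] in [e * e * y = e * y] gives [e * e = e]. *)
Lemma idempotent_in_left_ideal K : left_ideal K -> ~ K `<=` J ->
  exists e, [/\ K e, ~ J e & J (e * e - e)].
Proof.
move=> lK KJ.
have [x Kx nx] : exists2 x, K x & ~ exists u, J (u * (1 - x) - 1).
  apply: contrapT => qK; apply: KJ => x Kx; apply: radJ => r.
  apply: contrapT => nrx; apply: qK; exists (r * x) => //.
  by case: lK => _ _; apply.
have [|||n xS] := descending_stable (X := fun n => add_mulr setT (x ^+ n)) finJ.
- by move=> n; apply: left_ideal_add_mulr.
- by move=> n; apply: sub_add_mulr.
- by move=> n z [q _ Jq]; exists (q * x) => //; rewrite -mulrA -exprS.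
(* Iterating the stabilized inclusion, the power of x can be raised at will. *)
have surj k : exists w, J (x ^+ n - w * x ^+ (n + k)).
  elim: k => [|k [w Jw]]; first by exists 1; rewrite addn0 mul1r subrr.
  have [|u _ Ju] := xS (x ^+ n); first by exists 1; rewrite ?mul1r ?subrr.
  exists (w * u); rewrite addnS -addSn exprD.
  have -> : x ^+ n - w * u * (x ^+ n.+1 * x ^+ k) =
     x ^+ n - w * x ^+ (n + k) + w * (x ^+ n - u * x ^+ n.+1) * x ^+ k.
    rewrite exprD; move: (x ^+ n) (x ^+ k) (x ^+ n.+1) => a b c.
    non_commutative_ring.
  by apply: JD => //; apply: JMr; apply: JMl.
pose y := x ^+ n.+1.
have [w Jw] : exists w, J (y - w * y * y).
  have [w Jw] := surj n.+1; exists w; rewrite /y.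
  have -> : x ^+ n.+1 - w * x ^+ n.+1 * x ^+ n.+1 =
    (x ^+ n - w * x ^+ (n + n.+1)) * x.
    by rewrite mulrBl -exprSr -!mulrA -exprSr -exprD.
  exact: JMr.
pose e := w * y.
have Jey : J (y - e * y) by [].
have Ke : K e.
  by rewrite /e /y exprSr mulrA; case: lK => _ _ KM; apply: KM.
exists e; split=> //.
- move=> Je; apply: nx; apply: (@nilpotent_left_inv _ n.+1).
  by apply: (left_ideal_of_sub lJ Jey); apply: JMr.
have surjy : add_mulr setT y `<=` add_mulr (add_mulr setT y) y.
  move=> z [q _ Jq]; exists (q * e).
    by exists (q * w); rewrite // /e mulrA subrr.
  have -> : z - q * e * y = z - q * y + q * (y - e * y) by non_commutative_ring.
  by apply: JD => //; apply: JMl.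
apply: (mulr_surj_inj finJ surjy).
  exists (e * w - w) => //; suff -> : e * e - e - (e * w - w) * y = 0 by [].
  rewrite /e; non_commutative_ring.
have -> : (e * e - e) * y = - (e * (y - e * y)) by non_commutative_ring.
by apply: JN; apply: JMl.
Qed.

(** Otherwise the left ideal [T] generated by the products [e * r] would lie
    in the left ideal generated by [d], and idempotency of [e] would even
    give [T = T * d]. Then right multiplication by [d] would be injective on
    [T], although it kills the element [e] of [T]. *)
Lemma not_sub_corner d e : J (e * d) -> J (e * e - e) -> ~ J e ->
  exists r, ~ add_mulr setT d (e * r).
Proof.
move=> Jed Jee nJe; apply: contrapT => /forallNP corner.
have {}corner r : add_mulr setT d (e * r) by apply: contrapT; apply: corner.
pose gen X := [/\ left_ideal X, J `<=` X & forall r, X (e * r)].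
pose T := [set x | forall X, gen X -> X x].
have lT : left_ideal T.
  split; first by move=> X [[]].
  - move=> x y Tx Ty X genX; case: (genX) => -[_ XD _] _ _.
    by apply: XD; [exact: Tx|exact: Ty].
  - move=> r x Tx X genX; case: (genX) => -[_ _ XM] _ _.
    by apply: XM; exact: Tx.
have Te r : T (e * r) by move=> X [].
(* T is contained in T * d: it suffices that T * d is one of the left ideals
   whose intersection is T. *)
apply/nJe/(mulr_surj_inj (L := T) finJ _ _ Jed); last by rewrite -[e]mulr1.
move=> x; apply; split; first exact: left_ideal_add_mulr.
  by apply: sub_add_mulr; case: lT.
move=> r; have [p _ Jp] := corner r; exists (e * p); first exact: Te.
have -> : e * r - e * p * d = e * (e * r - p * d) - (e * e - e) * r.
  non_commutative_ring.
by apply: JB; [apply: JMl|apply: JMr].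
Qed.

(** Choose [c] in [B] such that [d := a + c] generates a left ideal of
    maximal rank. If [d] is not left invertible, its left annihilator
    contains an idempotent [e], and some [e * r] lies outside the left ideal
    of [d]. Writing [1 = p * a + b] with [b] in [B] transfers this to an
    element of [e * r * B]; adding it to [d] enlarges the left ideal of [d],
    since [(1 - e) * d = d] keeps [d] inside. *)
Lemma stable_range_semiprimitive a B p b : left_ideal B -> B b ->
  J (p * a + b - 1) -> exists c u, B c /\ J (u * (a + c) - 1).
Proof.
move=> lB Bb Jpb; have [B0 BD BM] := lB.
have [len [N [lenN len_lt]]] := finJ.
suff step k c : B c -> (N - len (add_mulr setT (a + c)) < k)%N ->
    exists c' u, B c' /\ J (u * (a + c') - 1).
  exact: (step N.+1 0 B0 (leq_subr _ _)).
elim: k c => // k IHk c Bc lek; set d := a + c in lek.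
have [[u Ju]|ndinv] := pselect (exists u, J (u * d - 1)); first by exists c, u.
have nKJ : ~ preim_mulr J d `<=` J.
  by move=> KJ; apply: ndinv; apply: mulr_inj_surj.
have lK := left_ideal_preim_mulr d lJ.
have [e [Jed nJe Jee]] := idempotent_in_left_ideal lK nKJ.
have [r nr] := not_sub_corner Jed Jee nJe.
(* Rewriting p * a + b = 1 in terms of d: p * d + b' = 1 modulo J. *)
pose b' := b - p * c; have Bb' : B b'.
  by apply: left_idealB => //; apply: BM.
pose c' := c + e * r * b'.
have Bc' : B c' by apply: BD => //; apply: BM.
apply: (IHk c') => //; rewrite -/d.
have ldA x : left_ideal (add_mulr setT x) by apply: left_ideal_add_mulr.
have dd' : a + c' = d + e * r * b' by rewrite /c' addrA.
have sub : add_mulr setT d `<=` add_mulr setT (a + c').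
  move=> x [q _ Jq]; exists (q * (1 - e)) => //; rewrite dd'.
  have -> : x - q * (1 - e) * (d + e * r * b') =
      x - q * d + q * (e * d) + q * (e * e - e) * r * b'.
    non_commutative_ring.
  apply: JD; first by apply: JD => //; apply: JMl.
  by apply: JMr; apply: JMr; apply: JMl.
rewrite -ltnS; apply: leq_trans lek; rewrite ltnS.
suff lt : (len (add_mulr setT d) < len (add_mulr setT (a + c')))%N.
  by apply: ltn_sub2l => //; apply: leq_trans lt (lenN _).
apply: len_lt => //; first exact: sub_add_mulr.
split=> // sub'; apply: nr.
have d'in : add_mulr setT (a + c') (a + c').
  by exists 1; rewrite // mul1r subrr.
have [q _ Jq] := sub' _ d'in.
(* If d' = q * d modulo J, then e * r * b' is a multiple of d, and so is e *
   r = e * r * (p * d + b'). *)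
exists (e * r * p + q - 1) => //.
have -> : e * r - (e * r * p + q - 1) * d =
   (a + c' - q * d) - e * r * (p * a + b - 1).
  rewrite dd' /b' /d; non_commutative_ring.
by apply: JB => //; apply: JMl.
Qed.

End Modulus.

(** Reduction to the semiprimitive case: the Jacobson radical of the quotient
    by the Jacobson radical vanishes, and left inverses lift along it. *)
Lemma stable_range J a B p b : two_sided_ideal J -> finite_length_mod J ->
  left_ideal B -> B b -> J (p * a + b - 1) ->
  exists c u, B c /\ J (u * (a + c) - 1).
Proof.
move=> J_ideal finJ lB Bb Jpb.
have JQ := sub_quasi_regular J_ideal.
have [|c [u [Bc Ju]]] := stable_range_semiprimitive
    (quasi_regular_ideal J_ideal) (finite_length_mod_sub JQ finJ) _ lB Bb
    (JQ _ Jpb).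
  move=> x qqx r; have [u qu] := qqx r.
  exact: quasi_regular_left_inv qu.
by have [v Jv] := quasi_regular_left_inv Ju; exists c, v.
Qed.

End Artinian.

(** * Maximal ideals of a commutative ring *)

Section MaximalIdeals.
Variable C : comNzRingType.
Implicit Types (M I : set C).

Lemma idealr_setP I : idealr_closed (mem I) <->
  [/\ I 0, ~ I 1, forall x y, I x -> I y -> I (x + y)
    & forall c x, I x -> I (c * x)].
Proof.
split=> [[I0 I1 IDM]|[I0 I1 ID IM]].
  have {}I0 : I 0 by exact/set_mem.
  have IM c x : I x -> I (c * x).
    by move=> Ix; rewrite -[_ * _]addr0; apply/set_mem/IDM; exact/mem_set.
  split=> //; first by move=> /mem_set; apply/negP.
  move=> x y Ix Iy; rewrite -[x]mul1r; apply/set_mem/IDM; exact/mem_set.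
split; [exact/mem_set|by apply/negP=> /set_mem|].
by move=> c x y /set_mem Ix /set_mem Iy; apply/mem_set/ID => //; apply: IM.
Qed.

(** The chains of sets to which Zorn's lemma is applied are made of sets [X]
    with [I `|` X] a proper ideal, so that the empty chain is harmless. *)
Lemma maximal_ideal_exists I :
  idealr_closed (mem I) -> exists2 M, Max C M & I `<=` M.
Proof.
move=> idI; pose P X := idealr_closed (mem (I `|` X)).
have [|M [PM maxM]] := @Zorn_bigcup C P.
  move=> F FP totF; have [I0 I1 ID IM] := (idealr_setP I).1 idI.
  apply/idealr_setP.
  split.
  - by left.
  - case=> // -[X FX X1]; have /idealr_setP [_ + _ _] := FP _ FX.
    by apply; right.
  - have lift X x y : F X -> (I `|` X) x -> (I `|` X) y ->
        (I `|` \bigcup_(X in F) X) (x + y).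
      move=> FX Xx Xy; have /idealr_setP [_ _ XD _] := FP _ FX.
      by case: (XD _ _ Xx Xy) => ?; [left|right; exists X].
    move=> x y [Ix|[X FX Xx]] [Iy|[Y FY Yy]].
    + by left; apply: ID.
    + by apply: (lift Y) => //; [left|right].
    + by apply: (lift X) => //; [right|left].
    + case: (totF _ _ FX FY) => sub.
      * by apply: (lift Y) => //; right => //; apply: sub.
      * by apply: (lift X) => //; right => //; apply: sub.
  - move=> c x [Ix|[X FX Xx]]; first by left; apply: IM.
    have /idealr_setP [_ _ _ XM] := FP _ FX.
    by case: (XM c x) => [|?|?]; [right|left|right; exists X].
exists (I `|` M); last by move=> x; left.
split=> // J idJ IMJ; apply: contrapT => JIM.
have /(maxM J) : M `<` J.
  split=> [x Mx|JM]; first by apply: IMJ; right.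
  by apply: JIM; apply/seteqP; split=> // x /JM; right.
apply; rewrite /P (_ : I `|` J = J) //; apply/seteqP; split=> x; last by right.
by case=> // Ix; apply: IMJ; left.
Qed.

Lemma maximal_ideal_inv M x : Max C M -> ~ M x -> exists y, M (1 - y * x).
Proof.
move=> [idM maxM] nMx; have [M0 M1 MD MM] := (idealr_setP M).1 idM.
apply: contrapT => noinv; apply: nMx.
pose J := [set z | exists c, M (z - c * x)].
have <- : J = M; last by exists 1; rewrite mul1r subrr.
apply: maxM => [|z Mz]; last by exists 0; rewrite mul0r subr0.
apply/idealr_setP; split.
- by exists 0; rewrite mul0r subr0.
- by case=> c Mc; apply: noinv; exists c.
- move=> y z [c Mc] [e Me]; exists (c + e).
  by rewrite mulrDl opprD addrACA; apply: MD.
- by move=> e z [c Mc]; exists (e * c); rewrite -mulrA -mulrBr; apply: MM.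
Qed.

(** Every permutation other than the identity moves some index, and so
    contributes a product with an off-diagonal factor, which lies in [M]. *)
Lemma det_sub1_mod_ideal M n (mu : 'M[C]_n) : idealr_closed (mem M) ->
  (forall p q, M (mu p q)) -> M (\det (1%:M - mu) - 1).
Proof.
move=> /idealr_setP[M0 M1 MD MM] Mmu.
rewrite /determinant (bigD1 1%g) //= odd_perm1 expr0 mul1r addrAC.
apply: (MD).
  apply: (big_ind (fun x => M (x - 1))).
  - by rewrite subrr.
  - move=> x y Mx My; rewrite (_ : x * y - 1 = x * (y - 1) + (x - 1)).
      by apply: (MD) => //; apply: (MM).
    by rewrite mulrBr mulr1 addrA subrK.
  - move=> p _; rewrite perm1 !mxE eqxx addrAC subrr add0r -mulN1r.
    exact: (MM).
apply: (big_ind M) => // s s1; apply: (MM).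
have [p sp] : exists p, s p != p.
  apply/existsP; apply: contraNT s1; rewrite negb_exists => /forallP fix_s.
  by apply/eqP/permP => p; rewrite perm1; apply/eqP; move/negPn: (fix_s p).
rewrite (bigD1 p) //= mulrC; apply: (MM); rewrite !mxE eq_sym (negbTE sp).
by rewrite sub0r -mulN1r; apply: (MM).
Qed.

End MaximalIdeals.

(** * Finitely generated modules over the center *)

Section CenterModules.
Variable R : nzRingType.
Local Notation C := (center R).
Variables (N : nat) (r : 'I_N -> R).
Hypothesis r_gen :
  forall x, exists c : 'I_N -> C, x = \sum_(p < N) center_val (c p) * r p.
Variable M : set C.
Hypothesis maxM : Max C M.

Let M0 : M 0. Proof. by case: maxM => /idealr_setP []. Qed.
Let M1 : ~ M 1. Proof. by case: maxM => /idealr_setP []. Qed.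
Let MD x y : M x -> M y -> M (x + y).
Proof. by case: maxM => /idealr_setP [_ _ + _] _; apply. Qed.
Let MM c x : M x -> M (c * x).
Proof. by case: maxM => /idealr_setP [_ _ _ +] _; apply. Qed.

Lemma center_val0 : center_val (0 : C) = 0. Proof. by []. Qed.
Lemma center_val1 : center_val (1 : C) = 1. Proof. by []. Qed.
Lemma center_valD (c e : C) : center_val (c + e) = center_val c + center_val e.
Proof. by []. Qed.
Lemma center_valN (c : C) : center_val (- c) = - center_val c.
Proof. by []. Qed.
Lemma center_valB (c e : C) : center_val (c - e) = center_val c - center_val e.
Proof. by []. Qed.
Lemma center_valM (c e : C) : center_val (c * e) = center_val c * center_val e.
Proof. by []. Qed.

Lemma center_mulC_val (c : C) x : center_val c * x = x * center_val c.
Proof. by case: c => c /= /asboolP. Qed.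

(** For [p = 0] this is the two-sided ideal of [R] generated by [M], and it
    grows up to [R] for [p = N]; two consecutive steps differ by a module
    generated by one element killed by [M], that is, by a vector space of
    dimension at most one over the residue field of [M]. *)
Definition span_mod (p : nat) := [set x | exists2 c : 'I_N -> C,
  (forall q : 'I_N, (p <= q)%N -> M (c q)) & x = \sum_q center_val (c q) * r q].

Lemma span_modD p x y : span_mod p x -> span_mod p y -> span_mod p (x + y).
Proof.
move=> [c Mc ->] [e Me ->]; exists (fun q => c q + e q).
  by move=> q pq; apply: MD; [apply: Mc|apply: Me].
by rewrite -big_split; apply: eq_bigr => q _; rewrite center_valD mulrDl.
Qed.

Lemma span_modZ p (e : C) x : span_mod p x -> span_mod p (center_val e * x).
Proof.
move=> [c Mc ->]; exists (fun q => e * c q).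
  by move=> q pq; apply: MM; apply: Mc.
by rewrite big_distrr; apply: eq_bigr => q _; rewrite center_valM -mulrA.
Qed.

Lemma span_mod_mul p (m : C) w : M m -> span_mod p (center_val m * w).
Proof.
move=> Mm; have [c ->] := r_gen w; exists (fun q => m * c q).
  by move=> q _; rewrite mulrC; apply: MM.
by rewrite big_distrr; apply: eq_bigr => q _; rewrite center_valM -mulrA.
Qed.

Lemma span_mod_sum p (m : 'I_N -> C) w : (forall q, M (m q)) ->
  span_mod p (\sum_q center_val (m q) * w q).
Proof.
move=> Mm; apply: (big_ind (span_mod p)).
- by rewrite -(mul0r 0) -center_val0; apply: span_mod_mul.
- exact: span_modD.
- by move=> q _; apply: span_mod_mul.
Qed.

Lemma span_mod0_ideal : two_sided_ideal (span_mod 0).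
Proof.
split; first split.
- by rewrite -(mul0r 0) -center_val0; apply: span_mod_mul.
- by move=> x y; apply: span_modD.
- move=> y _ [c Mc ->]; rewrite big_distrr.
  under eq_bigr do rewrite /= mulrA -center_mulC_val -mulrA.
  by apply: span_mod_sum => q; apply: Mc.
- move=> _ y [c Mc ->]; rewrite big_distrl.
  under eq_bigr do rewrite /= -mulrA.
  by apply: span_mod_sum => q; apply: Mc.
Qed.

(** The rank of a left ideal [X] counts its pivots, the steps of the
    filtration [span_mod] at which [X] contains an element with leading term
    [r p]. It is the dimension of [X] modulo [M * R] computed by row echelon
    form. If [X] is contained in [Y] and they have the same pivots, then
    subtracting multiples of elements of [X] from an element of [Y]
    eliminates its leading terms one after the other. *)
Lemma span_mod_finite_length : finite_length_mod (span_mod 0).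
Proof.
pose piv (X : set R) : {pred 'I_N} :=
  fun p => `[< exists2 x, X x & span_mod p (x - r p) >].
exists (fun X => #|piv X|), N; split=> [X|X Y lX lY JX [XY YX]].
  by rewrite -[leqRHS]card_ord max_card.
apply: proper_card; rewrite properE; apply/andP; split.
  apply/fintype.subsetP => p /asboolP[x Xx xp]; apply/asboolP; exists x => //.
  exact: XY.
apply/negP => /fintype.subsetP pivYX; apply: YX.
(* Gaussian elimination on the last coefficient that is nonzero modulo M. *)
have sub p : (p <= N)%N -> Y `&` span_mod p `<=` X.
  elim: p => [_ x [_ /JX] //|p IHp pN] _ [] /[swap] -[c Mc ->].
  set y := \sum_q _ => Yy.
  have [Mp|nMp] := pselect (M (c (Ordinal pN))).
    apply: IHp => //; first exact: ltnW.
    split=> //; exists c => // q; rewrite leq_eqVlt => /predU1P[pq|/Mc //].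
    by rewrite (_ : q = Ordinal pN) //; apply: val_inj.
  set P := Ordinal pN in nMp *.
  have pivot (e f : C) : M (e * c P - f) ->
        span_mod p (center_val e * y - center_val f * r P).
    move=> Mef; exists (fun q => e * c q - (if q == P then f else 0)) => [q|].
      have [->|qP] := eqVneq q P => // pq.
      rewrite subr0; apply/MM/Mc; rewrite ltn_neqAle pq andbT.
      by apply: contraNneq qP => pq'; apply/eqP/val_inj.
    under eq_bigr do rewrite center_valB center_valM mulrBl -mulrA.
    rewrite sumrB -big_distrr /=; congr (_ - _).
    rewrite (bigD1 P) //= eqxx big1 ?addr0 // => q /negbTE ->.
    by rewrite center_val0 mul0r.
  have [e Me] := maximal_ideal_inv maxM nMp.
  have [x Xx xP] : exists2 x, X x & span_mod p (x - r P).
    apply/asboolP/(pivYX P)/asboolP; exists (center_val e * y).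
      by case: lY => _ _; apply.
    rewrite -[r P]mul1r -center_val1; apply: pivot.
    by rewrite -opprB -mulN1r; apply: MM.
  apply: (@left_ideal_of_sub _ _ _ (center_val (c P) * x) lX); last first.
    by case: lX => _ _; apply.
  apply: IHp; first exact: ltnW.
  split.
    apply: left_idealB => //; apply: XY; by case: lX => _ _; apply.
  have -> : y - center_val (c P) * x =
     (center_val 1 * y - center_val (c P) * r P) +
     center_val (- c P) * (x - r P).
    rewrite center_val1 mul1r center_valN mulNr mulrBr opprB addrA addrAC.
    by rewrite [_ - _ + _]addrAC subrK.
  apply: span_modD; last exact: span_modZ.
  by apply: pivot; rewrite mul1r subrr.
move=> y Yy; apply: (sub N) => //; split=> //.
have [c ->] := r_gen y; exists c => // q.
by rewrite leqNgt ltn_ord.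
Qed.

(** Nakayama's lemma by the determinant trick. Each generator satisfies
    [r p = v p * d + \sum_q mu p q * r q] with [mu] over [M]; multiplying by
    the adjugate of [1 - mu] shows that the determinant [s], which is
    congruent to 1 modulo [M], maps every generator, hence 1, into [R * d]. *)
Lemma nakayama_left_inv d : (exists u, span_mod 0 (u * d - 1)) ->
  exists s u, ~ M s /\ center_val s = u * d.
Proof.
move=> [u Ju].
have ex p : exists mu : 'I_N -> C, (forall q, M (mu q)) /\
    exists v, r p = v * d + \sum_q center_val (mu q) * r q.
  have [mu Mmu def] : span_mod 0 (r p - r p * u * d).
    have [[_ _ JM] _] := span_mod0_ideal; have := JM (- r p) _ Ju.
    by rewrite mulrBr mulr1 opprK addrC mulNr -mulrA.
  exists mu; split; first by move=> q; apply: Mmu.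
  by exists (r p * u); rewrite -def addrC subrK.
have [mu [Mmu exmu]] : exists mu : 'M[C]_N, (forall p q, M (mu p q)) /\
    forall p, exists v, r p = v * d + \sum_q center_val (mu p q) * r q.
  exists (\matrix_(p, q) sval (cid (ex p)) q); split=> [p q|p].
    by rewrite mxE; case: cid => ? [].
  have [_ [v def]] := svalP (cid (ex p)); exists v; rewrite {1}def.
  by congr (_ + _); apply: eq_bigr => q _; rewrite mxE.
pose v p := sval (cid (exmu p)).
pose s := \det (1%:M - mu).
have sr q : center_val s * r q =
    (\sum_p center_val (\adj (1%:M - mu) q p) * v p) * d.
  have r_eq p : \sum_t center_val ((1%:M - mu) p t) * r t = v p * d.
    under eq_bigr do rewrite !mxE center_valB mulrBl.
    rewrite sumrB (bigD1 p) //= eqxx mulr1n center_val1 mul1r big1 ?addr0.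
      by rewrite [X in X - _](svalP (cid (exmu p))) addrK.
    by move=> t; rewrite eq_sym => /negbTE ->; rewrite mulr0n center_val0 mul0r.
  rewrite big_distrl /=.
  under [RHS]eq_bigr do rewrite -mulrA -r_eq big_distrr /=.
  rewrite exchange_big /=.
  under [RHS]eq_bigr => t _.
    under eq_bigr do rewrite mulrA -center_valM.
    rewrite -big_distrl /= (_ : \sum_p _ = center_val (s%:M q t)); last first.
      by rewrite -mul_adj_mx mxE (big_morph _ center_valD center_val0).
    over.
  rewrite (bigD1 q) //= big1 ?addr0 ?mxE ?eqxx // => t tq.
  by rewrite mxE eq_sym (negbTE tq) mul0r.
have [e def1] := r_gen 1.
exists s, (\sum_q center_val (e q) *
  (\sum_p center_val (\adj (1%:M - mu) q p) * v p)).
split.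
  have Ms1 : M (s - 1) := det_sub1_mod_ideal maxM.1 Mmu.
  move=> Ms; apply: M1; rewrite -[X in M X](subKr s) -mulN1r.
  by apply: MD => //; apply: MM.
rewrite -[LHS]mulr1 def1 big_distrr big_distrl; apply: eq_bigr => q _ /=.
by rewrite -mulrA -sr mulrA center_mulC_val -mulrA.
Qed.
End CenterModules.

(** The localization of [R] at [M] has stable range one, stated with a
    denominator [s] outside of [M] instead of a localized ring. *)
Lemma local_stable_range (R : nzRingType) (M : set (center R)) a B p b :
  almost_commutative R -> Max (center R) M -> left_ideal B -> B b ->
  p * a + b = 1 ->
  exists c (s : center R) u, [/\ B c, ~ M s & center_val s = u * (a + c)].
Proof.
move=> [N [r r_gen]] maxM lB Bb pab.
have [|c [u [Bc Ju]]] := stable_range (p := p) (a := a)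
  (span_mod0_ideal r_gen maxM) (span_mod_finite_length r_gen maxM) lB Bb.
  by rewrite pab subrr; case: (span_mod0_ideal r_gen maxM) => -[].
have [s [v [nMs sE]]] := nakayama_left_inv r_gen maxM (ex_intro _ u Ju).
by exists c, s, v.
Qed.

(** * Products of elementary conjugates *)

Section Conjugates.
Variables (n : nat) (R : nzRingType).
Local Notation G := (GL n R).
Implicit Types (sigma tau xi g h : G).

Lemma elementary_closed : group_closed (mem (@elementary n R)).
Proof.
split; first by apply/mem_set => H [[H1 _] _]; exact/set_mem.
move=> g h /set_mem Eg /set_mem Eh; apply/mem_set => H HE.
have [[_ HF] _] := HE.
by apply/set_mem/HF; apply/mem_set; [apply: Eg|apply: Eh].
Qed.

Lemma elementary1 : elementary (1%g : G).
Proof. by case: elementary_closed => /set_mem. Qed.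

Lemma elementaryV g : elementary g -> elementary (g^-1)%g.
Proof.
by move=> Eg; apply/set_mem/(group_closedV elementary_closed)/mem_set.
Qed.

Lemma elementaryM g h : elementary g -> elementary h -> elementary (g * h)%g.
Proof.
by move=> Eg Eh; apply/set_mem/(group_closedM elementary_closed); apply/mem_set.
Qed.

Lemma elementary_transvection i j (ij : i != j) (x : R) :
  elementary (transvection ij x : G).
Proof. by apply: sub_gen_smallest; exists i, j, ij, x. Qed.

Lemma conj_elementary_conjugate sigma g xi : elementary xi ->
  elementary_conjugates sigma g -> elementary_conjugates sigma (g ^ xi)%g.
Proof.
move=> Exi [rho Erho gE]; exists (rho * xi)%g; first exact: elementaryM.
by rewrite !conjgM; case: gE => ->; [left|right].
Qed.

Lemma inv_elementary_conjugate sigma g :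
  elementary_conjugates sigma g -> elementary_conjugates sigma (g^-1)%g.
Proof.
move=> [rho Erho gE]; exists rho => //.
by case: gE => ->; rewrite -conjVg ?invgK; [right|left].
Qed.

Lemma product_of_conjugates0 sigma : product_of_conjugates 0 sigma 1%g.
Proof. by exists (fun=> 1%g) => [[]//|]; rewrite big_ord0. Qed.

Lemma product_of_conjugates1 sigma g :
  elementary_conjugates sigma g -> product_of_conjugates 1 sigma g.
Proof. by move=> gE; exists (fun=> g) => //; rewrite big_ord1. Qed.

Lemma product_of_conjugatesM k m sigma g h :
  product_of_conjugates k sigma g -> product_of_conjugates m sigma h ->
  product_of_conjugates (k + m) sigma (g * h)%g.
Proof.
move=> [f fE ->] [f' f'E ->].
exists (fun p => match fintype.split p with inl q => f q | inr q => f' q end).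
  by move=> p; case: fintype.split.
rewrite big_split_ord; congr (_ * _)%g; apply: eq_bigr => q _.
  by rewrite (unsplitK (inl q)).
by rewrite (unsplitK (inr q)).
Qed.

Lemma product_of_conjugates_prod m r sigma (F : 'I_r -> G) :
  (forall p, product_of_conjugates m sigma (F p)) ->
  product_of_conjugates (r * m) sigma (\prod_p F p)%g.
Proof.
elim: r F => [|r IHr] F FE.
  by rewrite big_ord0; exact: product_of_conjugates0.
by rewrite big_ord_recl mulSn; apply: product_of_conjugatesM => //; exact: IHr.
Qed.

Lemma product_of_conjugatesV m sigma g :
  product_of_conjugates m sigma g -> product_of_conjugates m sigma (g^-1)%g.
Proof.
move=> [f fE ->]; elim: m f fE => [|m IHm] f fE.
  by rewrite big_ord0 invg1; exact: product_of_conjugates0.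
rewrite big_ord_recl invgM; move: (IHm _ (fun p => fE (lift ord0 p))).
have /inv_elementary_conjugate/product_of_conjugates1 := fE ord0.
by move=> f0 /product_of_conjugatesM /(_ f0); rewrite addn1.
Qed.

Lemma product_of_conjugatesJ m sigma g xi : elementary xi ->
  product_of_conjugates m sigma g -> product_of_conjugates m sigma (g ^ xi)%g.
Proof.
move=> Exi [f fE ->]; exists (fun p => (f p ^ xi)%g).
  by move=> p; apply: conj_elementary_conjugate.
by rewrite conjg_prod.
Qed.

(** An elementary conjugate of [g ^-1] costs as many factors as one of [g]. *)
Lemma product_of_conjugates_trans k m sigma g h :
  product_of_conjugates m sigma g -> product_of_conjugates k g h ->
  product_of_conjugates (k * m) sigma h.
Proof.
move=> gE [f fE ->]; apply: product_of_conjugates_prod => p.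
have [xi Exi [->|->]] := fE p; apply: product_of_conjugatesJ => //.
exact: product_of_conjugatesV.
Qed.

Lemma product_of_conjugates_commutator sigma xi m g : elementary xi ->
  product_of_conjugates m sigma g ->
  product_of_conjugates (m + m) sigma (g * (g^-1 ^ xi))%g /\
  product_of_conjugates (m + m) sigma (g ^ xi * g^-1)%g.
Proof.
by move=> Exi gE; split; apply: product_of_conjugatesM => //;
  do ?apply: product_of_conjugatesJ => //; apply: product_of_conjugatesV.
Qed.

End Conjugates.

(** * Row transvections and Steinberg relations *)

Section RowTransvections.
Variables (n : nat) (R : nzRingType).
Local Notation G := (GL n R).
Implicit Types (i j k l h : 'I_n) (v w : 'rV[R]_n).

Lemma mul_row_delta w j : w *m delta_mx j 0 = (w 0 j)%:M :> 'M_1.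
Proof. by rewrite -colE; apply/matrixP=> p q; rewrite !mxE !ord1 mulr1n. Qed.

Lemma row_transvection_mulmx j v w : v 0 j = 0 ->
  (1%:M + delta_mx j 0 *m v) *m (1%:M + delta_mx j 0 *m w) =
  1%:M + delta_mx j 0 *m (v + w) :> 'M[R]_n.
Proof.
move=> vj; rewrite mulmxDl mul1mx mulmxDr mulmx1 mulmxA -(mulmxA _ v).
rewrite mul_row_delta vj raddf0 mulmx0 mul0mx addr0 mulmxDr.
by rewrite -addrA [X in _ + X]addrC.
Qed.


Lemma row_transvection_mulmxN j w : w 0 j = 0 ->
  (1%:M + delta_mx j 0 *m w) *m (1%:M + delta_mx j 0 *m - w) = 1%:M :> 'M[R]_n.
Proof.
by move=> wj; rewrite row_transvection_mulmx // subrr mulmx0 addr0.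
Qed.

Lemma row_transvection_mulmxNl j w : w 0 j = 0 ->
  (1%:M + delta_mx j 0 *m - w) *m (1%:M + delta_mx j 0 *m w) = 1%:M :> 'M[R]_n.
Proof.
move=> wj; rewrite row_transvection_mulmx ?mxE ?wj ?oppr0 //.
by rewrite addNr mulmx0 addr0.
Qed.

Definition row_transvection j w (wj : w 0 j = 0) : G :=
  mkGL (row_transvection_mulmxN wj) (row_transvection_mulmxNl wj).

Lemma row_transvectionV j w (wj : w 0 j = 0) :
  ((row_transvection wj)^-1)%g = 1%:M + delta_mx j 0 *m - w :> 'M[R]_n.
Proof.
pose tauV := mkGL (row_transvection_mulmxNl wj) (row_transvection_mulmxN wj).
suff -> : ((row_transvection wj)^-1)%g = tauV by [].
by apply: mulg1_eq; apply: val_inj; exact: row_transvection_mulmxN.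
Qed.

Lemma transvection_rowE i j (x : R) :
  transvection_mx i j x = 1%:M + delta_mx i 0 *m (x *: delta_mx 0 j : 'rV_n).
Proof.
rewrite /transvection_mx; congr (_ + _); apply/matrixP => p q.
rewrite !mxE big_ord1 !mxE !eqxx andbT.
by case: (p == i); rewrite ?mul1r ?mul0r ?mulr0.
Qed.

Lemma row_transvection_comm j w w' (wj : w 0 j = 0) (wj' : w' 0 j = 0) :
  commute (row_transvection wj) (row_transvection wj').
Proof.
by apply: val_inj; rewrite /= !row_transvection_mulmx // [w + _]addrC.
Qed.

(** The row [w] is cleared one column at a time, each time splitting off a
    transvection. *)
Lemma elementary_row_transvection j w (wj : w 0 j = 0) :
  elementary (row_transvection wj).
Proof.
suff elem m (g : G) : (m <= n)%N ->
    (forall q : 'I_n, (m <= q)%N -> w 0 q = 0) ->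
    g = 1%:M + delta_mx j 0 *m w :> 'M[R]_n -> elementary g.
  by apply: (elem n) => // q; rewrite leqNgt ltn_ord.
elim: m w wj g => [|m IHm] w wj g mn w0 gE.
  suff -> : g = 1%g by exact: elementary1.
  apply: val_inj; rewrite /= gE (_ : w = 0) ?mulmx0 ?addr0 //.
  by apply/rowP => q; rewrite mxE w0.
(* The row w' is w with its last remaining column cleared. *)
set K := Ordinal mn; pose w' : 'rV_n := \row_q (if q == K then 0 else w 0 q).
have wj' : w' 0 j = 0 by rewrite mxE wj if_same.
have Ew' : elementary (row_transvection wj').
  apply: (IHm w') => //; first exact: ltnW.
  move=> q mq; rewrite mxE; have [//|qK] := eqVneq q K; apply: w0.
  rewrite ltn_neqAle mq andbT.
  by apply: contraNneq qK => mq'; apply/eqP/val_inj.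
have wE : w = w 0 K *: delta_mx 0 K + w'.
  apply/rowP => q; rewrite !mxE eqxx.
  by have [->|] := eqVneq q K; rewrite ?mulr1 ?addr0 ?mulr0 ?add0r.
have [jK|jK] := eqVneq j K.
  suff -> : g = row_transvection wj' by [].
  by apply: val_inj; rewrite /= gE wE -jK wj scale0r add0r.
suff -> : g = (transvection jK (w 0 K) * row_transvection wj')%g.
  by apply: elementaryM => //; exact: elementary_transvection.
apply: val_inj; rewrite /= gE transvection_rowE row_transvection_mulmx -?wE //.
by rewrite !mxE eqxx (negbTE jK) mulr0.
Qed.

Lemma transvection_row i j (ij : i != j) (x : R)
    (xi : (x *: delta_mx 0 j : 'rV[R]_n) 0 i = 0) :
  transvection ij x = row_transvection xi.
Proof. by apply: val_inj; rewrite /= transvection_rowE. Qed.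

Lemma scale_delta_row i j (ij : i != j) (x : R) :
  (x *: delta_mx 0 j : 'rV[R]_n) 0 i = 0.
Proof. by rewrite !mxE eqxx (negbTE ij) mulr0. Qed.

Lemma transvectionM i j (ij : i != j) (x y : R) :
  (transvection ij x * transvection ij y)%g = transvection ij (x + y) :> G.
Proof.
apply: val_inj; rewrite /= !transvection_rowE row_transvection_mulmx.
  by rewrite scalerDl.
exact: scale_delta_row.
Qed.

Lemma transvection0 i j (ij : i != j) : transvection ij (0 : R) = 1%g :> G.
Proof. by apply: val_inj; rewrite /= /transvection_mx scale0r addr0. Qed.

Lemma transvectionV i j (ij : i != j) (x : R) :
  ((transvection ij x)^-1)%g = transvection ij (- x) :> G.
Proof. by apply: mulg1_eq; rewrite transvectionM subrr transvection0. Qed.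

Lemma transvection_prod i j (ij : i != j) r (x : 'I_r -> R) :
  (\prod_p transvection ij (x p))%g = transvection ij (\sum_p x p) :> G.
Proof.
elim: r x => [|r IHr] x; first by rewrite !big_ord0 transvection0.
by rewrite !big_ord_recl IHr transvectionM.
Qed.

Lemma GLval_conj (g xi : G) :
  Defs.GLval (g ^ xi)%g =
    Defs.GLval (xi^-1)%g *m (Defs.GLval g *m Defs.GLval xi).
Proof. by []. Qed.

Lemma GLvalVl (g : G) : Defs.GLval (g^-1)%g *m Defs.GLval g = 1%:M.
Proof. by have /(congr1 val) := mulVg g. Qed.

Lemma GLvalVr (g : G) : Defs.GLval g *m Defs.GLval (g^-1)%g = 1%:M.
Proof. by have /(congr1 val) := mulgV g. Qed.

Lemma mul_scaled_delta m p (x y : R) (i : 'I_m) (j k : 'I_n) (l : 'I_p) :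
  (x *: delta_mx i j) *m (y *: delta_mx k l) =
  (x * y) *: delta_mx i l *+ (j == k).
Proof.
apply/matrixP => s t; rewrite !mxE (bigD1 j) //= big1 ?addr0.
  have [->|/negbTE jk] := eqVneq j k; rewrite ?mulr1n ?mulr0n !mxE ?jk.
    rewrite !eqxx andbT -!mulrA; congr (_ * _).
    by case: (s == i); rewrite /= ?mul1r ?mul0r ?mulr0.
  by rewrite !mulr0.
by move=> q /negbTE qj; rewrite !mxE qj andbF mulr0 mul0r.
Qed.

Lemma transvection_commutator i j k (ij : i != j) (jk : j != k) (ik : i != k)
    (x y : R) :
  (transvection ij x * transvection jk y * (transvection ij x)^-1 *
    (transvection jk y)^-1)%g = transvection ik (x * y) :> G.
Proof.
apply/eqP; rewrite divg_eq divg_eq; apply/eqP/val_inj.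
rewrite /= /transvection_mx.
rewrite !(mulmxDl, mulmxDr, mul1mx, mulmx1) !mul_scaled_delta !eqxx.
rewrite ![k == _]eq_sym (negbTE jk) (negbTE ik) !mulr0n !mulr1n mul0mx !addr0.
by rewrite -[RHS]addrA [X in _ = _ + X]addrC.
Qed.

End RowTransvections.

(** * Isolating a transvection in a matrix with a left invertible pivot *)

(** The commutator of [A] with [T * u] does not see the factor [u], provided
    that [u] commutes with [A]. *)
Lemma conj_mul_inv_absorb (G : groupType) (A T u : G) : commute A u ->
  ((T * u) ^ A^-1 * (T * u)^-1 = A * T * A^-1 * T^-1)%g.
Proof.
move=> /commute_sym/commuteV uA; rewrite conjgE invgK invgM !mulgA.
by rewrite -(mulgA _ u) uA !mulgA mulgK.
Qed.

Section PivotColumns.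
Variables (n : nat) (R : nzRingType).
Local Notation G := (GL n R).
Implicit Types (i j k l h p q : 'I_n) (sigma g : G) (x y a b z : R).

Lemma mul_GL_delta g j :
  Defs.GLval g *m delta_mx j 0 = col j (Defs.GLval g) :> 'cV_n.
Proof. by rewrite -colE. Qed.

(** Row [i] of [g] is mapped by the inverse of [g] to a basis vector. So
    conjugating the row transvection [tau] that adds to row [j] the multiple
    [y] of this row yields a matrix known from column [j] of [g] only: it is
    the product of the transvections [T] at [(h, i)] with entry [x * y] and
    at [(j, i)] with entry [y]. The commutator of [g] with [tau] is therefore
    [T * u] with [u] concentrated in row [j]; such a [u] commutes with the
    transvection at [(j, h)], and a second commutator leaves the Steinberg
    relation between the positions [(j, h)] and [(h, i)]. *)
Lemma product_of_column g i j h x a y (ji : j != i) :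
  h != i -> j != h ->
  Defs.GLval g *m delta_mx j 0 = delta_mx j 0 + delta_mx h 0 *m x%:M :> 'cV_n ->
  product_of_conjugates 4 g (transvection ji (a * x * y)).
Proof.
move=> hi jh gj; pose r : 'rV_n := y *: row i (Defs.GLval g).
have rj : r 0 j = 0.
  have /matrixP/(_ i 0) := gj; rewrite mul_GL_delta !mxE big_ord1 !mxE => ->.
  by rewrite ![i == _]eq_sym (negbTE ji) (negbTE hi) mul0r addr0 mulr0.
pose tau := row_transvection rj.
have Etau : elementary tau := elementary_row_transvection rj.
pose T := transvection hi (x * y); pose A := transvection jh a.
pose u := (transvection ji y * tau^-1)%g.
(* Both sides are 1 + (column j of g) * y * (basis row i). *)
have conjE : (g * tau * g^-1)%g = (T * transvection ji y)%g.
  apply: val_inj; rewrite /= mulmxDr mulmx1 mulmxDl GLvalVr mulmxA gj.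
  rewrite -mulmxA -scalemxAl rowE -mulmxA GLvalVr mulmx1 !transvection_rowE.
  rewrite mulmxDl -mulmxA mul_scalar_mx scalerA [RHS]mulmxDl mul1mx -addrA.
  congr (_ + _); rewrite mulmxDr mulmx1 mulmxA -(mulmxA _ _ (delta_mx j 0)).
  rewrite mul_row_delta (scale_delta_row ji) raddf0 mulmx0 mul0mx addr0.
  by [].
have Au : commute A u.
  rewrite /A (transvection_row jh (scale_delta_row jh a)).
  apply: commuteM; last by apply: commuteV; exact: row_transvection_comm.
  rewrite (transvection_row ji (scale_delta_row ji y)).
  exact: row_transvection_comm.
have gg : elementary_conjugates g g.
  by exists 1%g; [exact: elementary1|left; rewrite conjg1].
have [Pf _] := product_of_conjugates_commutator (elementaryV Etau)
  (product_of_conjugates1 gg).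
have [_] := product_of_conjugates_commutator
  (elementaryV (elementary_transvection jh a)) Pf.
suff -> : (g * g^-1 ^ tau^-1 = T * u)%g.
  rewrite -/A conj_mul_inv_absorb // /A /T.
  by rewrite (transvection_commutator jh hi ji) mulrA.
by rewrite conjgE invgK /u !mulgA conjE.
Qed.

(** The row vector [v] annihilates column [j] of [sigma], because
    [sigma i j * d' * sigma j j = s * sigma i j]. The transvection [tau]
    adding [v] to row [h] thus fixes that column, and the commutator of [tau]
    with [sigma] has the same column [j] as the inverse of [tau]. *)
Lemma pivot_column sigma i j h d' s (ij : i != j) : h != i -> h != j ->
  (forall x, s * x = x * s) -> d' * sigma j j = s ->
  exists g, product_of_conjugates 2 sigma g /\
   Defs.GLval g *m delta_mx j 0 =
     delta_mx j 0 + delta_mx h 0 *m (sigma i j * d')%:M :> 'cV_n.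
Proof.
move=> hi hj sC ds.
pose v : 'rV_n := s *: delta_mx 0 i - (sigma i j * d') *: delta_mx 0 j.
have vh : v 0 h = 0.
  by rewrite !mxE (negbTE hi) (negbTE hj) !mulr0 subrr.
pose tau := row_transvection vh.
have Etau : elementary tau := elementary_row_transvection vh.
exists ((sigma^-1 ^ tau) * sigma)%g; split.
  apply: (@product_of_conjugatesM _ _ 1 1); apply: product_of_conjugates1.
    by exists tau => //; right.
  by exists 1%g; [exact: elementary1|left; rewrite conjg1].
have vs : v *m (Defs.GLval sigma *m delta_mx j 0) = 0 :> 'M_1.
  rewrite /v mulmxBl -!scalemxAl -!rowE mul_GL_delta.
  apply/matrixP => p q; rewrite !mxE -mulrA ds sC.
  by rewrite subrr.
rewrite /= -!mulmxA mulmxDl mul1mx -[_ *m v *m _]mulmxA vs mulmx0 addr0.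
rewrite (mulmxA (Defs.GLval (sigma^-1)%g)) GLvalVl mul1mx row_transvectionV.
rewrite mulmxDl mul1mx -mulmxA mul_row_delta; congr (_ + _ *m _%:M).
by rewrite !mxE [j == i]eq_sym (negbTE ij) !eqxx !mulr0 sub0r mulr1 opprK.
Qed.

(** Choosing [y := sigma j j * b] in [product_of_column] turns the quotient
    [sigma i j * d'] back into [s * sigma i j]. *)
Lemma product_of_pivot sigma i j h d' s (ij : i != j) (ji : j != i) a b :
  h != i -> h != j -> (forall x, s * x = x * s) -> d' * sigma j j = s ->
  product_of_conjugates 8 sigma (transvection ji (s * (a * sigma i j * b))).
Proof.
move=> hi hj sC ds; have [g [Pg gj]] := pivot_column ij hi hj sC ds.
rewrite eq_sym in hj.
have := product_of_conjugates_trans Pg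
  (product_of_column a (sigma j j * b) ji hi hj gj).
rewrite (_ : a * _ * _ = s * (a * sigma i j * b)) //.
by rewrite !mulrA -[_ * d' * _]mulrA ds -!mulrA !sC !mulrA.
Qed.

(** Conjugation by the row transvection that adds [z] to row [j] changes
    column [j] in its [j]-th entry only, and makes this entry left invertible
    up to [s]. *)
Lemma product_of_left_inv sigma i j h d' s (z : 'rV[R]_n) (ij : i != j)
    (ji : j != i) a b :
  h != i -> h != j -> z 0 j = 0 -> (forall x, s * x = x * s) ->
  d' * (sigma j j + (z *m Defs.GLval sigma) 0 j) = s ->
  product_of_conjugates 8 sigma (transvection ji (s * (a * sigma i j * b))).
Proof.
move=> hi hj zj sC ds; pose rho := row_transvection zj.
pose sigma1 := (sigma ^ rho^-1)%g.
have Erho : elementary (rho^-1)%g.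
  exact: elementaryV (elementary_row_transvection zj).
have col1 : Defs.GLval sigma1 *m delta_mx j 0 =
    (1%:M + delta_mx j 0 *m z) *m (Defs.GLval sigma *m delta_mx j 0) :> 'cV_n.
  rewrite /sigma1 GLval_conj invgK -!mulmxA row_transvectionV.
  do 2!congr (_ *m _); rewrite mulmxDl mul1mx -mulmxA mul_row_delta mxE zj.
  by rewrite oppr0 raddf0 mulmx0 addr0.
have entry p :
    sigma1 p j = sigma p j + (p == j)%:R * (z *m Defs.GLval sigma) 0 j.
  have /matrixP/(_ p 0) := col1.
  rewrite mulmxDl mul1mx -[_ *m z *m _]mulmxA (mulmxA z) -!colE.
  by rewrite !mxE big_ord1 !mxE andbT => ->.
have P1 : product_of_conjugates 1 sigma sigma1.
  by apply: product_of_conjugates1; exists (rho^-1)%g => //; left.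
have ds1 : d' * sigma1 j j = s by rewrite entry eqxx mul1r.
have := product_of_conjugates_trans P1
  (product_of_pivot ij ji a b hi hj sC ds1).
by rewrite muln1 entry (negbTE ij) mul0r addr0.
Qed.

Lemma mulmx_transvection_delta i j x k :
  transvection_mx i j x *m delta_mx k 0 =
  delta_mx k 0 + (x *: delta_mx i 0) *+ (j == k) :> 'cV[R]_n.
Proof.
rewrite /transvection_mx mulmxDl mul1mx; congr (_ + _).
by rewrite -[delta_mx k 0]scale1r mul_scaled_delta mulr1.
Qed.

Lemma mulmx_delta_transvection i j x k :
  delta_mx 0 k *m transvection_mx i j x =
  delta_mx 0 k + (x *: delta_mx 0 j) *+ (k == i) :> 'rV[R]_n.
Proof.
rewrite /transvection_mx mulmxDr mulmx1; congr (_ + _).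
by rewrite -[delta_mx 0 k]scale1r mul_scaled_delta mul1r.
Qed.

Lemma transvection_conj p q k l (pq : p != q) (kl : k != l) (xi : G) z :
  Defs.GLval xi *m delta_mx k 0 = delta_mx p 0 :> 'cV_n ->
  delta_mx 0 q *m Defs.GLval xi = delta_mx 0 l :> 'rV_n ->
  (transvection pq z ^ xi)%g = transvection kl z :> G.
Proof.
move=> xik qxi; rewrite conjgE; apply: (mulgI xi); rewrite mulVKg.
apply: val_inj; rewrite /= !transvection_rowE mulmxDl mulmxDr mul1mx mulmx1.
by rewrite -mulmxA -scalemxAl qxi mulmxA xik.
Qed.

(** A product of two transvections moves the basis row [q] to the basis row
    [l] and fixes column [p]; no sign appears, in contrast to the conjugation
    by a monomial matrix. *)
Lemma transvection_conj_col p q l (pq : p != q) (pl : p != l) :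
  exists2 xi : G, elementary xi &
    forall z, (transvection pq z ^ xi)%g = transvection pl z.
Proof.
have [ql|ql] := eqVneq q l.
  exists 1%g; first exact: elementary1.
  by move=> z; rewrite conjg1; apply: val_inj; rewrite /= ql.
have lq : l != q by rewrite eq_sym.
exists (transvection ql 1 * transvection lq (-1))%g.
  by apply: elementaryM; exact: elementary_transvection.
move=> z; apply: transvection_conj => /=.
  rewrite -mulmxA mulmx_transvection_delta // [q == p]eq_sym (negbTE pq) addr0.
  by rewrite mulmx_transvection_delta // [l == p]eq_sym (negbTE pl) addr0.
rewrite mulmxA mulmx_delta_transvection // eqxx mulr1n scale1r mulmxDl.
rewrite !mulmx_delta_transvection // eqxx (negbTE ql) mulr0n mulr1n addr0.
by rewrite scaleN1r addrC addrNK.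
Qed.

Lemma transvection_conj_row p q k (pq : p != q) (kq : k != q) :
  exists2 xi : G, elementary xi &
    forall z, (transvection pq z ^ xi)%g = transvection kq z.
Proof.
have [pk|pk] := eqVneq p k.
  exists 1%g; first exact: elementary1.
  by move=> z; rewrite conjg1; apply: val_inj; rewrite /= pk.
have kp : k != p by rewrite eq_sym.
exists (transvection kp (-1) * transvection pk 1)%g.
  by apply: elementaryM; exact: elementary_transvection.
move=> z; apply: transvection_conj => /=.
  rewrite -mulmxA mulmx_transvection_delta // eqxx mulr1n scale1r mulmxDr.
  rewrite !mulmx_transvection_delta // eqxx (negbTE pk) mulr0n mulr1n addr0.
  by rewrite scaleN1r addrCA subrr addr0.
rewrite mulmxA mulmx_delta_transvection // [q == _]eq_sym (negbTE kq) addr0.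
by rewrite mulmx_delta_transvection // [q == _]eq_sym (negbTE pq) addr0.
Qed.

Lemma third_index i j : (3 <= n)%N -> exists h : 'I_n, h != i /\ h != j.
Proof.
move=> n3; have /card_gt0P[h] : (0 < #|~: [set i; j]%SET|)%N.
  have := cardsC [set i; j]%SET; rewrite card_ord => cardn.
  have := cards2 i j; case: (i != j) => c2; rewrite c2 in cardn; lia.
by rewrite !inE negb_or => /andP[hi hj]; exists h.
Qed.

(** The detour through a third index [h] keeps every intermediate position
    off the diagonal. *)
Lemma transvection_conj_all p q k l (pq : p != q) (kl : k != l) :
  (3 <= n)%N -> exists2 xi : G, elementary xi &
    forall z, (transvection pq z ^ xi)%g = transvection kl z.
Proof.
move=> n3; have [h [hp hk]] : exists h : 'I_n, h != p /\ h != k.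
  exact: third_index.
have ph : p != h by rewrite eq_sym.
have kh : k != h by rewrite eq_sym.
have [x Ex xE] := transvection_conj_col pq ph.
have [y Ey yE] := transvection_conj_row ph kh.
have [z Ez zE] := transvection_conj_col kh kl.
exists (x * y * z)%g; first by do ?apply: elementaryM.
by move=> t; rewrite !conjgM xE yE zE.
Qed.

End PivotColumns.

(** * From local to global *)

Section PartitionOfUnity.
Variable C : comNzRingType.
Variable s : set C -> C.
Hypothesis s_notin : forall M, Max C M -> ~ M (s M).

(** The list [L] is free of repetitions: the final bound counts distinct
    maximal ideals. *)
Definition unity_combination := [set x |
  exists (L : seq (set C)) (c : set C -> C),
  [/\ uniq L, forall X, X \in L -> Max C X & x = \sum_(X <- L) c X * s X]].

Lemma unity_combination_add1 x (e : C) Y : Max C Y -> unity_combination x ->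
  unity_combination (x + e * s Y).
Proof.
move=> maxY [L [c [uL maxL ->]]]; have [YL|YL] := boolP (Y \in L).
  exists L, (fun X => c X + (if X == Y then e else 0)); split=> //.
  under [RHS]eq_bigr do rewrite mulrDl.
  rewrite big_split /= [X in _ = _ + X](bigD1_seq Y) //= eqxx.
  rewrite [X in _ = _ + (_ + X)]big1 ?addr0 // => X /negbTE ->.
  by rewrite mul0r.
exists (Y :: L), (fun X => if X == Y then e else c X); split.
- by rewrite /= YL.
- by move=> X; rewrite inE => /predU1P[->|/maxL].
- rewrite big_cons eqxx addrC; congr (_ + _); apply: eq_big_seq => X XL.
  by case: eqVneq XL YL => // -> ->.
Qed.

(** The combinations form an ideal that contains [s M] for each maximal [M],
    so no maximal ideal contains it. *)
Lemma partition_of_unity : exists (r : nat) (F : 'I_r -> set C) (c : 'I_r -> C),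
  [/\ injective F, forall p, Max C (F p) & \sum_p c p * s (F p) = 1].
Proof.
suff [L [c [uL maxL ->]]] : unity_combination 1.
  exists (size L), (fun p => nth set0 L p), (fun p => c (nth set0 L p)); split.
  - by move=> p q /eqP; rewrite nth_uniq // => /eqP /val_inj.
  - by move=> p; apply/maxL/mem_nth.
  - by rewrite (big_nth set0) big_mkord.
apply: contrapT => J1.
have idJ : idealr_closed (mem unity_combination).
  apply/idealr_setP; split=> //.
  - by exists [::], (fun=> 0); rewrite big_nil.
  - move=> x y Jx [L [c [_ maxL ->]]].
    elim: L maxL x Jx => [|Y L IHL] maxL x Jx; first by rewrite big_nil addr0.
    rewrite big_cons addrA; apply: IHL.
      by move=> X XL; apply: maxL; rewrite inE XL orbT.
    by apply: unity_combination_add1 => //; apply: maxL; rewrite inE eqxx.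
  - move=> e x [L [c [uL maxL ->]]]; exists L, (fun X => e * c X); split=> //.
    by rewrite big_distrr; apply: eq_bigr => X _; rewrite -mulrA.
have [M maxM JM] := maximal_ideal_exists idJ.
apply: (s_notin maxM); apply: JM; exists [:: M], (fun=> 1); split=> //.
  by move=> X; rewrite inE => /eqP ->.
by rewrite big_seq1 mul1r.
Qed.

End PartitionOfUnity.

Definition injects_in_Max (C : comNzRingType) (r : nat) :=
  exists2 F : 'I_r -> set C, injective F & forall p, Max C (F p).

(** Euclidean division by [k]. *)
Lemma card_le_mul_Max (C : comNzRingType) k r m :
  injects_in_Max C r -> (m <= r * k)%N -> `I_m #<= `I_k `*` Max C.
Proof.
move=> [F F_inj maxF] mrk; apply/pcard_leP/injfunPex.
have divlt q : (q < m)%N -> (q %/ k < r)%N.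
  move=> qm; have k0 : (0 < k)%N by case: k mrk => //; lia.
  by rewrite ltn_divLR //; exact: leq_trans mrk.
exists (fun q => ((q %% k)%N, odflt set0 (omap F (insub (q %/ k)%N)))).
  move=> q /= qm; rewrite insubT /= ?divlt // => lt; split=> //=.
  by rewrite ltn_mod; case: k mrk {lt divlt} => //; lia.
move=> p q /set_mem pm /set_mem qm.
rewrite !insubT ?divlt // => ltp ltq [modE /F_inj [divE]].
by rewrite (divn_eq p k) divE modE -divn_eq.
Qed.

Lemma mulmx_transvection_entry (R : nzRingType) n (A : 'M[R]_n) i j x p :
  (A *m transvection_mx i j x) p j = A p j + A p i * x.
Proof.
rewrite /transvection_mx mulmxDr mulmx1 mxE; congr (_ + _).
rewrite mxE (bigD1 i) //= !mxE !eqxx mulr1 big1 ?addr0 // => q /negbTE qi.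
by rewrite !mxE qi mulr0 mulr0.
Qed.

Lemma transvection_mulmx_entry (R : nzRingType) n (A : 'M[R]_n) i j x q :
  (transvection_mx i j x *m A) i q = A i q + x * A j q.
Proof.
rewrite /transvection_mx mulmxDl mul1mx mxE; congr (_ + _).
rewrite mxE (bigD1 j) //= !mxE !eqxx mulr1 big1 ?addr0 // => p /negbTE pj.
by rewrite !mxE pj andbF mulr0 mul0r.
Qed.

Section Main.
Variables (n : nat) (R : nzRingType).
Hypotheses (hn : (3 <= n)%N) (hR : almost_commutative R).
Local Notation G := (GL n R).
Local Notation C := (center R).
Implicit Types (sigma : G) (i j k l : 'I_n).

(** Column [j] of [sigma] is unimodular, as the inverse of [sigma] shows.
    Stable range one at [M], applied to the entry [sigma j j] and to the left
    ideal [B] generated by the other entries of the column, provides the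
    pivot. *)
Lemma local_product_of_conjugates sigma i j k l (ij : i != j) (kl : k != l)
    (M : set C) : Max C M -> exists2 s : C, ~ M s &
  forall a b, product_of_conjugates 8 sigma
    (transvection kl (center_val s * (a * sigma i j * b))).
Proof.
move=> maxM; have ji : j != i by rewrite eq_sym.
have [h [hi hj]] := third_index i j hn.
pose B := [set x | exists2 z : 'rV[R]_n,
  z 0 j = 0 & x = (z *m Defs.GLval sigma) 0 j].
have lB : left_ideal B.
  split.
  - by exists 0; rewrite ?mul0mx mxE.
  - move=> _ _ [z zj ->] [w wj ->]; exists (z + w).
      by rewrite mxE zj wj addr0.
    by rewrite mulmxDl [RHS]mxE.
  - move=> e _ [z zj ->]; exists (e *: z); first by rewrite mxE zj mulr0.
    by rewrite -scalemxAl [RHS]mxE.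
have [w wsigma] : exists w : 'rV_n, w *m Defs.GLval sigma = delta_mx 0 j.
  exists (delta_mx 0 j *m Defs.GLval (sigma^-1)%g).
  by rewrite -mulmxA GLvalVl mulmx1.
(* The part of w off the position j, so that z * sigma uses only the other
   entries of the column. *)
pose z := w - w 0 j *: delta_mx 0 j.
have Bz : B ((z *m Defs.GLval sigma) 0 j).
  by exists z => //; rewrite !mxE !eqxx mulr1 subrr.
have unim : w 0 j * sigma j j + (z *m Defs.GLval sigma) 0 j = 1.
  rewrite /z mulmxBl -scalemxAl wsigma -rowE.
  by rewrite !mxE !eqxx addrCA subrr addr0.
have [_ [s [d' [[z' z'j ->] nMs sE]]]] := local_stable_range hR maxM lB Bz unim.
exists s => // a b.
have [xi Exi xiE] := transvection_conj_all R ji kl hn.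
rewrite -xiE; apply: product_of_conjugatesJ => //.
apply: (product_of_left_inv ij ji a b hi hj z'j) => [x|].
  exact: center_mulC_val.
by rewrite sE.
Qed.

(** Split the entry along a partition of unity made of the local
    denominators; each summand costs eight conjugates. *)
Lemma entry_product_of_conjugates sigma i j k l (ij : i != j) (kl : k != l)
    a b :
  exists2 r, injects_in_Max C r &
    product_of_conjugates (r * 8) sigma (transvection kl (a * sigma i j * b)).
Proof.
have ex (M : set C) : exists s : C, Max C M -> ~ M s /\
    forall a b, product_of_conjugates 8 sigma
      (transvection kl (center_val s * (a * sigma i j * b))).
  have [maxM|nmaxM] := pselect (Max C M); last by exists 0.
  by have [s] := local_product_of_conjugates sigma ij kl maxM; exists s.
pose s M := sval (cid (ex M)).
have sP M (maxM : Max C M) := svalP (cid (ex M)) maxM.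
have [r [F [c [F_inj maxF sum1]]]] :=
  partition_of_unity (fun M maxM => (sP M maxM).1).
exists r; first by exists F.
have -> : a * sigma i j * b =
    \sum_p center_val (s (F p)) * (center_val (c p) * a * sigma i j * b).
  rewrite -[LHS]mul1r -(center_val1 R) -sum1.
  rewrite (big_morph _ (@center_valD R) (@center_val0 R)) big_distrl.
  apply: eq_bigr => p _; rewrite [c p * _]mulrC center_valM /=.
  by rewrite !mulrA.
rewrite -transvection_prod; apply: product_of_conjugates_prod => p.
exact: (sP _ (maxF p)).2.
Qed.

End Main.

(** * The main theorem *)

#[local] Existing Instance pzRing_ops.
#[local] Existing Instance pzRing_Ring.

Theorem theorem32 (n : nat) (hn : (3 <= n)%N) (R : nzRingType)
    (hR : almost_commutative R) (sigma : GL n R) (i j k l : 'I_n)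
    (ij : i != j) (kl : k != l) (a b c : R) :
  (exists2 m : nat,
      `I_m #<= `I_8 `*` Max (center R) &
      product_of_conjugates m sigma (transvection kl (a * sigma i j * b))) /\
  (exists2 m : nat,
      `I_m #<= `I_24 `*` Max (center R) &
      product_of_conjugates m sigma
        (transvection kl (a * (c * sigma i i - sigma j j * c) * b))).
Proof.
have ji : j != i by rewrite eq_sym.
split.
  have [r rMax P] := entry_product_of_conjugates hn hR sigma ij kl a b.
  by exists (r * 8)%N => //; apply: card_le_mul_Max rMax _.
(* The entry of sigma1 at (j, i) is c * sigma i i - sigma j j * c up to two
   terms that involve only off-diagonal entries of sigma, whence three
   applications of the first part. *)
pose sigma1 := (sigma ^ transvection ji (- c))%g.
have P1 : product_of_conjugates 1 sigma sigma1.
  apply: product_of_conjugates1; exists (transvection ji (- c)); last by left.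
  exact: elementary_transvection.
have entry : sigma1 j i =
    sigma j i + (c * sigma i i - sigma j j * c) - c * sigma i j * c.
  rewrite /sigma1 conjgE transvectionV opprK /= transvection_mulmx_entry.
  rewrite !mulmx_transvection_entry mulrDr !mulrN mulrA.
  move: (sigma j i) (sigma i i) (sigma j j) (sigma i j) => x y z w.
  non_commutative_ring.
have [r1 r1Max Q1] := entry_product_of_conjugates hn hR sigma1 ji kl a b.
have [r2 r2Max Q2] := entry_product_of_conjugates hn hR sigma ji kl (- a) b.
have [r3 r3Max Q3] :=
  entry_product_of_conjugates hn hR sigma ij kl (a * c) (c * b).
exists (r1 * 8 * 1 + r2 * 8 + r3 * 8)%N; last first.
  have -> : a * (c * sigma i i - sigma j j * c) * b =
     a * sigma1 j i * b + - a * sigma j i * b + a * c * sigma i j * (c * b).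
    rewrite entry; move: (sigma j i) (sigma i i) (sigma j j) (sigma i j).
    move=> x y z w; non_commutative_ring.
  rewrite -!transvectionM; do 2?apply: product_of_conjugatesM => //.
  exact: product_of_conjugates_trans P1 Q1.
(* A common injection into Max serves the three products. *)
have [r [rMax le1 le2 le3]] : exists r, [/\ injects_in_Max (center R) r,
    (r1 <= r)%N, (r2 <= r)%N & (r3 <= r)%N].
  have [le12|/ltnW le21] := leqP r1 r2; have [le23|/ltnW le32] := leqP r2 r3.
  - by exists r3; split=> //; exact: leq_trans le23.
  - by exists r2.
  - have [le13|/ltnW le31] := leqP r1 r3; first by exists r3.
    by exists r1.
  - by exists r1; split=> //; exact: leq_trans le21.
by apply: card_le_mul_Max rMax _; lia.
Qed.
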